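(* Let $n,p$ be integers with $2\leq p\leq n-1$ and let $\beta\in(0,2]$. Then the $\beta$-length $\ell_\beta$ of a shortest geodesic loop on the Stiefel manifold $\mathrm{St}_\beta(n,p)$ is given by $$\ell_\beta=\min\{\sqrt{2\beta},1\}\,2\pi .$$
   Context: For integers $1\le p\le n$, $\mathrm{St}(n,p)=\{U\in\mathbb{R}^{n\times p} : U^\top U=I_p\}$, with tangent spaces $T_U\mathrm{St}(n,p)=\{\Delta\in\mathbb{R}^{n\times p} : U^\top\Delta \text{ is skew-symmetric}\}$. Any $\Delta\in T_U\mathrm{St}(n,p)$ is written $\Delta=UA+U_\perp B$ with $A=U^\top\Delta\in\mathrm{Skew}(p)$ (the real skew-symmetric $p\times p$ matrices), $B\in\mathbb{R}^{(n-p)\times p}$ and $[U\ U_\perp]\in\mathrm{O}(n)$. For $\beta>0$, the $\beta$-metric is $\langle\Delta_1,\Delta_2\rangle_\beta=\beta\,\mathrm{tr}(A_1^\top A_2)+\mathrm{tr}(B_1^\top B_2)$, and $\mathrm{St}_\beta(n,p)$ denotes $\mathrm{St}(n,p)$ with this Riemannian metric ($\beta=1$: Euclidean metric, $\beta=\frac12$: canonical metric). With $I_{n\times p}=[I_p\ 0]^\top$, the geodesic from $I_{n\times p}$ with initial velocity $\begin{bmatrix}A\\ B\end{bmatrix}$ is $\gamma_\beta(t)=\exp_{\mathrm m}\left(t\begin{bmatrix}2\beta A&-B^\top\\ B&0\end{bmatrix}\right)I_{n\times p}\exp_{\mathrm m}(t(1-2\beta)A)$, where $\exp_{\mathrm m}$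 is the matrix exponential. The $\beta$-length of a curve is its Riemannian length in the $\beta$-metric. A geodesic loop is a nonconstant geodesic segment that begins and ends at the same point (no condition on the velocities at the endpoints). $\ell_\beta$ is the minimal $\beta$-length of geodesic loops; since $\mathrm{St}_\beta(n,p)$ is homogeneous, the starting point may be taken to be $I_{n\times p}$. *)

(* Defs.v *)
From mathcomp Require Import all_boot all_order all_algebra.
From mathcomp Require Import all_classical all_reals all_analysis.
Import Order.TTheory GRing.Theory Num.Theory.
Import numFieldNormedType.Exports.

Set Implicit Arguments.
Unset Strict Implicit.
Unset Printing Implicit Defensive.

Local Open Scope classical_set_scope.
Local Open Scope ring_scope.

Definition expm (R : realType) (n : nat) (X : 'M[R]_n) : 'M[R]_n :=
  limn (series (fun k : nat => (k`!%:R)^-1 *: X ^+ k)).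

Definition stiefel (R : realType) (n p : nat) : set 'M[R]_(n, p) :=
  [set U | U^T *m U = 1%:M].

Definition tangent (R : realType) (n p : nat) (U : 'M[R]_(n, p)) :
    set 'M[R]_(n, p) :=
  [set D | (U^T *m D)^T = - (U^T *m D)].

(* [U V] \in O(n).  For p <= n the width p + (n - p) equals n, but only
   propositionally, so orthogonality is stated on both sides. *)
Definition orthogonal_completion (R : realType) (n p : nat)
    (U : 'M[R]_(n, p)) : set 'M[R]_(n, n - p) :=
  [set V | (row_mx U V)^T *m row_mx U V = 1%:M /\
           row_mx U V *m (row_mx U V)^T = 1%:M].

(* A choice of U_perp.  One exists whenever p <= n and U is in St(n, p), and two
   choices differ by right multiplication by an element of O(n - p), which
   changes neither the metric nor the geodesics below. *)
Definition perp (R : realType) (n p : nat) (U : 'M[R]_(n, p)) :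
    'M[R]_(n, n - p) :=
  xget 0 (orthogonal_completion U).

(* The coordinates of D = U A + U_perp B. *)
Definition coordA (R : realType) (n p : nat) (U D : 'M[R]_(n, p)) : 'M[R]_p :=
  U^T *m D.

Definition coordB (R : realType) (n p : nat) (U D : 'M[R]_(n, p)) :
    'M[R]_(n - p, p) :=
  (perp U)^T *m D.

Definition beta_metric (R : realType) (n p : nat) (beta : R)
    (U D1 D2 : 'M[R]_(n, p)) : R :=
  beta * \tr ((coordA U D1)^T *m coordA U D2)
  + \tr ((coordB U D1)^T *m coordB U D2).

Definition beta_length (R : realType) (n p : nat) (beta : R)
    (c : R -> 'M[R]_(n, p)) (a b : R) : R :=
  \int[lebesgue_measure]_(t in `[a, b])
    Num.sqrt (beta_metric beta (c t) (derive1 c t) (derive1 c t)).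

(* The geodesic of St_beta(n, p) from U with initial velocity D: the known
   geodesic from I_{n x p} with velocity [A; B], moved by the isometry
   X |-> [U U_perp] X, which sends I_{n x p} to U and [A; B] to D. *)
Definition geodesic (R : realType) (n p : nat) (beta : R)
    (U D : 'M[R]_(n, p)) (t : R) : 'M[R]_(n, p) :=
  let A := coordA U D in
  let B := coordB U D in
  row_mx U (perp U)
  *m expm (t *: block_mx ((2 * beta) *: A) (- B^T) B 0)
  *m col_mx 1%:M 0
  *m expm ((t * (1 - 2 * beta)) *: A).

(* Only the endpoints have to agree, not the velocities there. *)
Definition geodesic_loop (R : realType) (n p : nat) (beta : R)
    (U D : 'M[R]_(n, p)) (T : R) : Prop :=
  [/\ stiefel U, tangent U D, 0 < T,
      geodesic beta U D T = geodesic beta U D 0 &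
      exists2 t, t \in `[0, T] & geodesic beta U D t <> geodesic beta U D 0].

Definition loop_lengths (R : realType) (n p : nat) (beta : R) : set R :=
  [set l | exists (U D : 'M[R]_(n, p)) (T : R),
     geodesic_loop beta U D T /\
     l = beta_length beta (geodesic beta U D) 0 T].

Definition shortest_loop_length (R : realType) (n p : nat) (beta ell : R) :
    Prop :=
  loop_lengths n p beta ell /\ lbound (loop_lengths n p beta) ell.

(* Main.v *)
Require Import Defs.
From mathcomp Require Import all_boot all_order all_algebra.
From mathcomp Require Import all_classical all_reals all_analysis.
From mathcomp Require Import ring lra zify.
Import Order.TTheory GRing.Theory Num.Theory.
Import numFieldNormedType.Exports.

(** Up to the isometry of left multiplication by an orthogonal frame, a
    geodesic is t |-> G t = exp (t M) J exp (- t C), where J = I_{n x p},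
    M = [[2 beta A, - B^T], [B, 0]] and C = (2 beta - 1) A.  It is the solution
    through J of the linear equation X' = L X, with L X = M X - X C
    ([is_flow]).  Since M and C are skew, L is skew for the Frobenius product,
    so the Frobenius norms of G' and of G'' do not depend on time, and can be
    read off at time 0:
      G' 0 = [A; B]   and   G'' 0 = [A^2 - B^T B; 2 (1 - beta) B A].

    Lower bound.  A curve with |G'| constant and |G''| <= k |G'| has a unit
    tangent that turns with speed at most k.  As in Schur's comparison theorem,
    the angle between G' t and the tangent at the middle of a time interval of
    length T is at most k |t - T / 2|, so that G T - G 0 has a positive
    component along that tangent as soon as k T < 2 pi
    ([bounded_curvature_no_loop]).  A loop of time T therefore satisfies
      (2 pi / T)^2 |G'|^2 <= |G''|^2.
    With a = |A|^2 and b = |B|^2 one has |G'|^2 = a + b, and since a skew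
    matrix satisfies |X A|^2 <= |X|^2 |A|^2 / 2, because its singular values
    come in equal pairs,
      |G''|^2 <= a^2 / 2 + b^2 + (1 + 2 (1 - beta)^2) a b.
    For 0 < beta <= 2 the right-hand side is at most
    (a + b) (beta a + b) / min (2 beta, 1) ([beta_pinching]).  Cancelling
    a + b leaves min (2 beta, 1) (2 pi)^2 <= T^2 (beta a + b), and
    T sqrt (beta a + b) is the beta-length of the loop ([geodesic_length]).

    Equality.  A geodesic whose velocity is 2 pi N J with N^3 = - N, N skew
    and M a multiple of N, is given by Rodrigues' formula
    (1 + sin (2 pi t) N + (1 - cos (2 pi t)) N^2) J and closes up at time 1.
    If B = 0 and A is 2 pi times the generator of the rotations of a coordinate
    plane, the length is sqrt (2 beta) 2 pi; if A = 0 and B is 2 pi times a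
    matrix unit, it is 2 pi. *)

Set Implicit Arguments.
Unset Strict Implicit.
Unset Printing Implicit Defensive.

Local Open Scope classical_set_scope.
Local Open Scope ring_scope.

(** * The Frobenius product and the curvature estimate *)

Definition frob (R : realType) (m n : nat) (X Y : 'M[R]_(m, n)) : R :=
  \tr (X^T *m Y).

Section Frobenius.
Context {R : realType}.
Implicit Types m n k : nat.

Lemma frobE m n (X Y : 'M[R]_(m, n)) :
  frob X Y = \sum_i \sum_j X i j * Y i j.
Proof.
rewrite /frob /mxtrace exchange_big; apply: eq_bigr => j _.
by rewrite mxE; apply: eq_bigr => i _; rewrite mxE.
Qed.

Lemma frobC m n (X Y : 'M[R]_(m, n)) : frob X Y = frob Y X.
Proof. by rewrite /frob -mxtrace_tr trmx_mul trmxK. Qed.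

Lemma frobDl m n (X Y Z : 'M[R]_(m, n)) :
  frob (X + Y) Z = frob X Z + frob Y Z.
Proof. by rewrite /frob linearD mulmxDl mxtraceD. Qed.

Lemma frobNl m n (X Y : 'M[R]_(m, n)) : frob (- X) Y = - frob X Y.
Proof. by rewrite /frob linearN mulNmx linearN. Qed.

Lemma frobZl m n c (X Y : 'M[R]_(m, n)) : frob (c *: X) Y = c * frob X Y.
Proof. by rewrite /frob linearZ -scalemxAl mxtraceZ. Qed.

Lemma frobBl m n (X Y Z : 'M[R]_(m, n)) :
  frob (X - Y) Z = frob X Z - frob Y Z.
Proof. by rewrite frobDl frobNl. Qed.

Lemma frobDr m n (X Y Z : 'M[R]_(m, n)) :
  frob X (Y + Z) = frob X Y + frob X Z.
Proof. by rewrite frobC frobDl !(frobC X). Qed.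

Lemma frobNr m n (X Y : 'M[R]_(m, n)) : frob X (- Y) = - frob X Y.
Proof. by rewrite frobC frobNl frobC. Qed.

Lemma frobBr m n (X Y Z : 'M[R]_(m, n)) :
  frob X (Y - Z) = frob X Y - frob X Z.
Proof. by rewrite frobDr frobNr. Qed.

Lemma frobZr m n c (X Y : 'M[R]_(m, n)) : frob X (c *: Y) = c * frob X Y.
Proof. by rewrite frobC frobZl frobC. Qed.

Lemma frob0r m n (X : 'M[R]_(m, n)) : frob X 0 = 0.
Proof. by rewrite /frob mulmx0 mxtrace0. Qed.

Lemma frob_ge0 m n (X : 'M[R]_(m, n)) : 0 <= frob X X.
Proof.
by rewrite frobE; do 2!apply: sumr_ge0 => ? _; rewrite -expr2 sqr_ge0.
Qed.

Lemma frob_eq0 m n (X : 'M[R]_(m, n)) : frob X X = 0 -> X = 0.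
Proof.
have ge0 i j : 0 <= X i j * X i j by rewrite -expr2 sqr_ge0.
rewrite frobE => /eqP.
rewrite psumr_eq0 => [/allP X0|i _]; last exact: sumr_ge0.
apply/matrixP => i j; have := X0 i (mem_index_enum i).
rewrite psumr_eq0 // => /allP /(_ j (mem_index_enum j)) /=.
by rewrite -expr2 sqrf_eq0 mxE => /eqP.
Qed.

Lemma frob_mull m n k (M : 'M[R]_(m, k)) X (Y : 'M[R]_(m, n)) :
  frob (M *m X) Y = frob X (M^T *m Y).
Proof. by rewrite /frob trmx_mul mulmxA. Qed.

Lemma frob_mulr m n k (X : 'M[R]_(m, k)) (C : 'M[R]_(k, n)) Y :
  frob (X *m C) Y = frob X (Y *m C^T).
Proof. by rewrite /frob trmx_mul -mulmxA mxtrace_mulC mulmxA. Qed.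

Lemma frob_tr m n (X Y : 'M[R]_(m, n)) : frob X^T Y^T = frob X Y.
Proof. by rewrite /frob trmxK mxtrace_mulC -mxtrace_tr trmx_mul trmxK. Qed.

Lemma frob_col_mx m1 m2 n (X1 Y1 : 'M[R]_(m1, n)) (X2 Y2 : 'M[R]_(m2, n)) :
  frob (col_mx X1 X2) (col_mx Y1 Y2) = frob X1 Y1 + frob X2 Y2.
Proof. by rewrite /frob tr_col_mx mul_row_col mxtraceD. Qed.

Lemma frob_rows m n (X Y : 'M[R]_(m, n)) :
  frob X Y = \sum_i frob (row i X) (row i Y).
Proof.
rewrite frobE; apply: eq_bigr => i _; rewrite frobE big_ord1.
by apply: eq_bigr => j _; rewrite !mxE.
Qed.

(** Cauchy-Schwarz, from the nonnegativity of the square norm of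
    |Y|^2 X - <X, Y> Y. *)
Lemma frob_CS m n (X Y : 'M[R]_(m, n)) :
  frob X Y ^+ 2 <= frob X X * frob Y Y.
Proof.
have [Y0|Yn0] := eqVneq (frob Y Y) 0.
  rewrite Y0 (frob_eq0 Y0) /frob mulmx0 mxtrace0; nra.
have Y0 : 0 < frob Y Y by rewrite lt0r Yn0 frob_ge0.
have := frob_ge0 (frob Y Y *: X - frob X Y *: Y).
have -> : frob (frob Y Y *: X - frob X Y *: Y) (frob Y Y *: X - frob X Y *: Y)
    = frob Y Y * (frob X X * frob Y Y - frob X Y ^+ 2).
  by rewrite !(frobBl, frobBr, frobZl, frobZr) (frobC Y X); ring.
by rewrite pmulr_rge0 // subr_ge0.
Qed.

Lemma frob_mul_le m n k (X : 'M[R]_(m, k)) (Y : 'M[R]_(k, n)) :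
  frob (X *m Y) (X *m Y) <= frob X X * frob Y Y.
Proof.
rewrite -(frob_tr Y) (frob_rows X) (frob_rows Y^T) frobE mulr_suml.
apply: ler_sum => i _; rewrite mulr_sumr; apply: ler_sum => j _.
have -> : (X *m Y) i j = frob (row i X) (row j Y^T).
  rewrite frobE big_ord1 !mxE; apply: eq_bigr => l _.
  by rewrite !mxE.
by rewrite -expr2 frob_CS.
Qed.

Lemma mul_row_tr n (x y : 'rV[R]_n) : x *m y^T = (frob x y)%:M.
Proof.
by rewrite [LHS]mx11_scalar /frob mxtrace_mulC -mxtrace_tr trmx_mul trmxK
  [in RHS]/mxtrace big_ord1.
Qed.

(** The operator norm of a skew matrix is bounded by its Frobenius norm divided
    by sqrt 2.  With y = x A orthogonal to x, the bivector W = x^T y - y^T x has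
    <A, W> = 2 |y|^2 and |W|^2 = 2 |x|^2 |y|^2, so the bound is Cauchy-Schwarz
    for A and W. *)
Lemma skew_row_mul_le n (A : 'M[R]_n) (x : 'rV[R]_n) : A^T = - A ->
  2 * frob (x *m A) (x *m A) <= frob x x * frob A A.
Proof.
move=> skA; have [y yE] : exists y, y = x *m A by exists (x *m A).
rewrite -yE; pose W := x^T *m y - y^T *m x.
have yx0 : frob y x = 0.
  have : frob y x = - frob y x.
    by rewrite {1}yE frob_mulr skA mulmxN frobNr -yE frobC.
  by move=> h; lra.
have AW : frob A W = 2 * frob y y.
  rewrite frobBr (frobC _ (x^T *m y)) (frobC _ (y^T *m x)) !frob_mull !trmxK.
  by rewrite -yE (frobC x (y *m A)) frob_mulr skA mulmxN frobNr -yE; ring.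
have WW : frob W W = 2 * (frob x x * frob y y).
  rewrite !(frobBl, frobBr) !frob_mull !trmxK !mulmxA !mul_row_tr.
  rewrite !mul_scalar_mx.
  by rewrite !frobZr (frobC x y) yx0; ring.
have := frob_CS A W; rewrite AW WW.
have := frob_ge0 y; rewrite le_eqVlt => /predU1P[<- _|y0].
  by rewrite mulr0 mulr_ge0 ?frob_ge0.
have -> : (2 * frob y y) ^+ 2 = 2 * frob y y * (2 * frob y y) by rewrite expr2.
have -> : frob A A * (2 * (frob x x * frob y y))
  = 2 * frob y y * (frob x x * frob A A) by ring.
by rewrite ler_pM2l // mulr_gt0.
Qed.

Lemma skew_mul_le m n (A : 'M[R]_n) (X : 'M[R]_(m, n)) : A^T = - A ->
  2 * frob (X *m A) (X *m A) <= frob X X * frob A A.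
Proof.
move=> skA; rewrite frob_rows (frob_rows X) mulr_sumr mulr_suml.
by apply: ler_sum => i _; rewrite row_mul; exact: skew_row_mul_le.
Qed.

(** The bound beta <= 2 enters through the factor 2 - beta: the difference of
    the two sides is
      (1 - 2 beta) b^2 + (1 - beta) (1 - 2 beta)^2 a b    if 2 beta <= 1,
      (beta - 1/2) a^2 + (2 beta - 1) (2 - beta) a b      otherwise. *)
Lemma beta_pinching (beta a b : R) : 0 < beta -> beta <= 2 ->
    0 <= a -> 0 <= b ->
  Num.min (2 * beta) 1 *
    (a ^+ 2 / 2 + b ^+ 2 + (1 + 2 * (1 - beta) ^+ 2) * (a * b))
  <= (a + b) * (beta * a + b).
Proof.
move=> be0 be2 a0 b0; have ab0 : 0 <= a * b by exact: mulr_ge0.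
have [le1|gt1] := leP (2 * beta) 1.
  rewrite -subr_ge0.
  have -> : (a + b) * (beta * a + b) - 2 * beta *
      (a ^+ 2 / 2 + b ^+ 2 + (1 + 2 * (1 - beta) ^+ 2) * (a * b))
    = (1 - 2 * beta) * b ^+ 2 + (1 - beta) * (1 - 2 * beta) ^+ 2 * (a * b)
    by field.
  apply: addr_ge0; first by rewrite mulr_ge0 ?sqr_ge0 // subr_ge0.
  rewrite mulr_ge0 // mulr_ge0 ?sqr_ge0 //; lra.
rewrite mul1r -subr_ge0.
have -> : (a + b) * (beta * a + b) -
      (a ^+ 2 / 2 + b ^+ 2 + (1 + 2 * (1 - beta) ^+ 2) * (a * b))
    = (beta - 2^-1) * a ^+ 2 + (2 * beta - 1) * (2 - beta) * (a * b) by field.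
apply: addr_ge0; first by rewrite mulr_ge0 ?sqr_ge0 //; lra.
by rewrite mulr_ge0 // mulr_ge0; lra.
Qed.

(** The left-hand sum is the squared Frobenius norm of the acceleration of the
    geodesic with velocity [A; B]; the right-hand side is its squared Frobenius
    speed times its squared beta-speed. *)
Lemma accel_le m p (beta : R) (A : 'M[R]_p) (B : 'M[R]_(m, p)) :
  0 < beta -> beta <= 2 -> A^T = - A ->
  Num.min (2 * beta) 1 *
    (frob (A *m A - B^T *m B) (A *m A - B^T *m B)
     + frob ((2 * (1 - beta)) *: (B *m A)) ((2 * (1 - beta)) *: (B *m A)))
  <= (frob A A + frob B B) * (beta * frob A A + frob B B).
Proof.
move=> be0 be2 skA; set a := frob A A; set b := frob B B.
apply: le_trans (beta_pinching be0 be2 (frob_ge0 A) (frob_ge0 B)).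
rewrite ler_wpM2l //; first by rewrite le_min ler01 andbT mulr_ge0 // ltW.
have AAle := skew_mul_le A skA; have BAle := skew_mul_le B skA.
have BBle := frob_mul_le B^T B; rewrite frob_tr in BBle.
have cross : frob (A *m A) (B^T *m B) = - frob (B *m A) (B *m A).
  rewrite frobC frob_mull trmxK mulmxA.
  by rewrite frobC frob_mulr skA mulmxN frobNr frobC.
rewrite !(frobBl, frobBr, frobZl, frobZr) (frobC (B^T *m B)) cross.
have be2' : 0 <= (1 - beta) ^+ 2 by exact: sqr_ge0.
rewrite -/a -/b in AAle BAle BBle *; move: AAle BAle BBle.
set x := frob (A *m A) _; set y := frob (B *m A) _.
set z := frob (B^T *m B) _; set d := _ ^+ 2 in be2' * => AAle BAle BBle.
have -> : x - - y - (- y - z) + 2 * (1 - beta) * (2 * (1 - beta) * y)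
  = x + z + (1 + 2 * d) * (2 * y) by rewrite /d; ring.
have : (1 + 2 * d) * (2 * y) <= (1 + 2 * d) * (b * a).
  by rewrite ler_wpM2l //; lra.
rewrite (mulrC b a) !expr2; lra.
Qed.

End Frobenius.

(** * Differentiating matrix curves and the exponential *)

Section MatrixCurves.
Context {R : realType}.
Implicit Types m n k : nat.

(** Reduces the calculus of matrix curves to that of their entries. *)
Lemma is_derive_mxP m n (F : R -> 'M[R]_(m, n)) (t : R) (F' : 'M[R]_(m, n)) :
  is_derive t 1 F F' <->
  forall i j, is_derive t 1 (fun s => F s i j) (F' i j).
Proof.
split=> [[dF <-] i j|dF].
  apply: DeriveDef; first exact: (derivable_mxP _ _ _).1.
  by rewrite derive_mx // mxE.
have derF : derivable F t 1 by apply/derivable_mxP => i j; case: (dF i j).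
apply: DeriveDef => //; rewrite derive_mx //.
by apply/matrixP => i j; rewrite mxE; case: (dF i j).
Qed.

Lemma is_derive_bigsum n (h : 'I_n -> R -> R) (dh : 'I_n -> R) (t : R) :
  (forall i, is_derive t 1 (h i) (dh i)) ->
  is_derive t 1 (fun s => \sum_i h i s) (\sum_i dh i).
Proof.
move=> dhi; have := is_derive_sum dhi.
rewrite (_ : \sum_i h i = fun s => \sum_i h i s) //.
by apply/funext => s; rewrite fct_sumE.
Qed.

Lemma is_derive_mulmx m n k (F : R -> 'M[R]_(m, k)) (G : R -> 'M[R]_(k, n))
    (t : R) F' G' : is_derive t 1 F F' -> is_derive t 1 G G' ->
  is_derive t 1 (fun s => F s *m G s) (F' *m G t + F t *m G').
Proof.
move=> /is_derive_mxP dF /is_derive_mxP dG; apply/is_derive_mxP => i j.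
have -> : (fun s => (F s *m G s) i j) = fun s => \sum_l F s i l * G s l j.
  by apply/funext => s; rewrite mxE.
apply: is_derive_eq.
  by apply: is_derive_bigsum => l; exact: is_deriveM (dF i l) (dG l j).
rewrite !mxE -big_split; apply: eq_bigr => l _ /=.
by rewrite addrC /GRing.scale /= (mulrC (G t l j)).
Qed.

Lemma is_derive_trmx m n (F : R -> 'M[R]_(m, n)) (t : R) F' :
  is_derive t 1 F F' -> is_derive t 1 (fun s => (F s)^T) F'^T.
Proof.
move=> /is_derive_mxP dF; apply/is_derive_mxP => i j.
rewrite mxE (_ : (fun _ => _) = fun s => F s j i) //.
by apply/funext => s; rewrite mxE.
Qed.

Lemma is_derive_frob m n (F G : R -> 'M[R]_(m, n)) (t : R) F' G' :
  is_derive t 1 F F' -> is_derive t 1 G G' ->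
  is_derive t 1 (fun s => frob (F s) (G s)) (frob F' (G t) + frob (F t) G').
Proof.
move=> /is_derive_trmx dF dG; have /is_derive_mxP dFG := is_derive_mulmx dF dG.
apply: is_derive_eq; first by apply: is_derive_bigsum => l; exact: dFG.
by rewrite /frob -mxtraceD.
Qed.

Lemma is_derive_cst_mulmx m n k (M : 'M[R]_(m, k)) (F : R -> 'M[R]_(k, n))
    (t : R) F' : is_derive t 1 F F' ->
  is_derive t 1 (fun s => M *m F s) (M *m F').
Proof.
move=> dF; have := is_derive_mulmx (is_derive_cst M t 1) dF.
by rewrite mul0mx add0r.
Qed.

Lemma is_derive_mulmx_cst m n k (F : R -> 'M[R]_(m, k)) (C : 'M[R]_(k, n))
    (t : R) F' : is_derive t 1 F F' ->
  is_derive t 1 (fun s => F s *m C) (F' *m C).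
Proof.
move=> dF; have := is_derive_mulmx dF (is_derive_cst C t 1).
by rewrite mulmx0 addr0.
Qed.

Lemma is_derive_scale_cst m n (f : R -> R) (X : 'M[R]_(m, n)) (t f' : R) :
  is_derive t 1 f f' -> is_derive t 1 (fun s => f s *: X) (f' *: X).
Proof.
move=> df; apply/is_derive_mxP => i j; have := is_deriveZ (X i j) df.
rewrite mxE [_ *: _]mulrC (_ : _ \*: _ = fun s => (f s *: X) i j) //.
by apply/funext => s; rewrite mxE mulrC.
Qed.

Lemma cvg_mx m n (S : nat -> 'M[R]_(m, n)) (L : 'M[R]_(m, n)) :
  (forall i j, (fun N => S N i j) @ \oo --> L i j) -> S @ \oo --> L.
Proof.
move=> SL; apply/cvgrPdist_le => /= e e0; near=> N.
rewrite /Num.Def.normr/= mx_normrE (bigmax_le _ (ltW e0))//= => i _.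
rewrite !mxE; move: i; near: N; apply: filter_forall => /= i.
exact: ((cvgrPdist_le _ _).1 (SL i.1 i.2)).
Unshelve. all: by end_near. Qed.

End MatrixCurves.

Section Exponential.
Context {R : realType} (n : nat).
Implicit Types (X Y : 'M[R]_n) (x : R).

(** Coefficients in x of the (i, j) entry of Y *m expm (x *: X).  The left
    factor Y makes the family stable under differentiation in x, which turns Y
    into Y *m X. *)
Definition expm_coeff X Y (i j : 'I_n) : R^nat :=
  fun k => (k`!%:R)^-1 * (Y *m X ^+ k) i j.

Definition mx_l1 X : R := \sum_i \sum_j `|X i j|.

Lemma mx_l1_ge0 X : 0 <= mx_l1 X.
Proof. by do 2!apply: sumr_ge0 => ? _. Qed.

Lemma row_l1_le X i : \sum_j `|X i j| <= mx_l1 X.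
Proof.
rewrite [leRHS](bigD1 i) //= lerDl.
by do 2!apply: sumr_ge0 => ? _.
Qed.

Lemma normr_expmx_le X k i j : `|(X ^+ k) i j| <= mx_l1 X ^+ k.
Proof.
elim: k i j => [|k IHk] i j.
  by rewrite !expr0 mxE; case: (i == j); rewrite ?normr1 ?normr0.
rewrite !exprS mxE; apply: le_trans (ler_norm_sum _ _ _) _.
apply: (@le_trans _ _ (\sum_l `|X i l| * mx_l1 X ^+ k)).
  by apply: ler_sum => l _; rewrite normrM ler_wpM2l.
by rewrite -mulr_suml ler_wpM2r ?row_l1_le // exprn_ge0 // mx_l1_ge0.
Qed.

Lemma normr_expm_coeff_le X Y i j k :
  `|expm_coeff X Y i j k| <= mx_l1 Y * exp_coeff (mx_l1 X) k.
Proof.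
rewrite /expm_coeff /exp_coeff /= normrM ger0_norm ?invr_ge0 // mulrC mulrA.
rewrite ler_wpM2r ?invr_ge0 // mxE; apply: le_trans (ler_norm_sum _ _ _) _.
apply: (@le_trans _ _ (\sum_l `|Y i l| * mx_l1 X ^+ k)).
  by apply: ler_sum => l _; rewrite normrM ler_wpM2l // normr_expmx_le.
by rewrite -mulr_suml ler_wpM2r ?row_l1_le // exprn_ge0 // mx_l1_ge0.
Qed.

(** Dominated by the scalar exponential series at |X|_1 |x|. *)
Lemma is_cvg_expm_coeff X Y i j x : cvgn (pseries (expm_coeff X Y i j) x).
Proof.
apply: normed_cvg; apply: (@series_le_cvg _ _
  (fun k => mx_l1 Y * exp_coeff (mx_l1 X * `|x|) k)).
- by move=> k; exact: normr_ge0.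
- move=> k; rewrite mulr_ge0 ?mx_l1_ge0 // exp_coeff_ge0 //.
  by rewrite mulr_ge0 ?mx_l1_ge0.
- move=> k /=; rewrite normrM normrX.
  apply: le_trans (ler_wpM2r (exprn_ge0 _ (normr_ge0 x))
    (normr_expm_coeff_le X Y i j k)) _.
  by rewrite /exp_coeff /= exprMn -!mulrA [_^-1 * _]mulrC.
- exact: is_cvg_seriesZ (is_cvg_series_exp_coeff (mx_l1 X * `|x|)).
Qed.

Lemma pseries_diffs_expm_coeff X Y i j :
  pseries_diffs (expm_coeff X Y i j) = expm_coeff X (Y *m X) i j.
Proof.
apply/funext => k; rewrite /pseries_diffs /expm_coeff factS natrM invfM mulrA.
by rewrite mulVKf // exprS mulmxA.
Qed.

Lemma is_derive_expm_coeff X Y i j x :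
  is_derive x 1 (fun s => limn (pseries (expm_coeff X Y i j) s))
    (limn (pseries (expm_coeff X (Y *m X) i j) x)).
Proof.
rewrite -pseries_diffs_expm_coeff.
apply: (@pseries_snd_diffs _ _ (`|x| + 1)); rewrite ?pseries_diffs_expm_coeff;
  try exact: is_cvg_expm_coeff.
by rewrite [ltRHS]ger0_norm ?ltrDl ?addr_ge0.
Qed.

Lemma exprZmx X x k : (x *: X) ^+ k = x ^+ k *: X ^+ k.
Proof.
elim: k => [|k IHk]; first by rewrite !expr0 scale1r.
by rewrite !exprS IHk -[LHS]scalemxAl -[in LHS]scalemxAr scalerA.
Qed.

Lemma series_expm_cvg X x :
  series (fun k => (k`!%:R)^-1 *: (x *: X) ^+ k) @ \oo -->
  \matrix_(i, j) limn (pseries (expm_coeff X 1%:M i j) x).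
Proof.
apply: cvg_mx => i j; rewrite mxE.
rewrite (_ : (fun _ => _) = pseries (expm_coeff X 1%:M i j) x).
  exact: is_cvg_expm_coeff.
apply/funext => N; rewrite /pseries /series /= summxE.
apply: eq_bigr => k _; rewrite /expm_coeff mxE exprZmx mxE mul1mx.
by rewrite mulrCA mulrC.
Qed.

Lemma expmE X x :
  expm (x *: X) = \matrix_(i, j) limn (pseries (expm_coeff X 1%:M i j) x).
Proof. by apply/cvg_lim => //; exact: series_expm_cvg. Qed.

Lemma mul_expmE X Y i j x :
  (Y *m expm (x *: X)) i j = limn (pseries (expm_coeff X Y i j) x).
Proof.
rewrite expmE mxE; apply/esym/cvg_lim => //.
rewrite (_ : pseries _ _ = fun N =>
    \sum_l Y i l * pseries (expm_coeff X 1%:M l j) x N).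
  apply: cvg_big; first exact: add_continuous.
  move=> l _; rewrite mxE; apply: cvgMl_tmp.
  exact: is_cvg_expm_coeff.
apply/funext => N; rewrite /pseries /series /=.
under [RHS]eq_bigr do rewrite mulr_sumr.
rewrite exchange_big; apply: eq_bigr => k _ /=.
rewrite /expm_coeff mxE mulr_sumr mulr_suml; apply: eq_bigr => l _.
by rewrite mul1mx; ring.
Qed.

Lemma is_derive_expm X x :
  is_derive x 1 (fun s => expm (s *: X)) (X *m expm (x *: X)).
Proof.
apply/is_derive_mxP => i j; rewrite mul_expmE.
have := is_derive_expm_coeff X 1%:M i j x; rewrite mul1mx.
congr (is_derive _ _ _ _); apply/funext => s.
by rewrite -mul_expmE mul1mx.
Qed.


Lemma expm0 : expm (0 : 'M[R]_n) = 1%:M.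
Proof.
apply/cvg_lim => //; apply: cvg_near_cst; near=> N.
have : (0 < N)%N by near: N; exact: nbhs_infty_gt.
rewrite /series /= => N0; rewrite big_ltn // big_nat big1 => [|[|k] // _].
  by rewrite addr0 expr0 fact0 invr1 scale1r.
by rewrite exprS mul0r scaler0.
Unshelve. all: by end_near. Qed.

(** Entrywise, both sides are sums of the same power series, since X commutes
    with its powers. *)
Lemma expm_comm X x : X *m expm (x *: X) = expm (x *: X) *m X.
Proof.
apply/matrixP => i j; rewrite mul_expmE; apply/cvg_lim => //.
rewrite expmE mxE (_ : pseries _ _ = fun N =>
    \sum_l pseries (expm_coeff X 1%:M i l) x N * X l j).
  apply: cvg_big; first exact: add_continuous.
  move=> l _; rewrite mxE; apply: cvgMr_tmp; exact: is_cvg_expm_coeff.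
apply/funext => N; rewrite /pseries /series /=.
under [RHS]eq_bigr do rewrite mulr_suml.
rewrite exchange_big; apply: eq_bigr => k _ /=.
rewrite /expm_coeff -[X *m X ^+ k]/(X * X ^+ k) -exprS exprSr.
rewrite [X in _ * X * _]mxE.
rewrite mulr_sumr mulr_suml; apply: eq_bigr => l _.
by rewrite mul1mx; ring.
Qed.

End Exponential.

(** * Comparison with the cosine *)

Section Comparison.
Context {R : realType}.

Lemma mvt_global (f df : R -> R) (a b : R) :
    (forall t : R, is_derive t 1 f (df t)) -> a <= b ->
  exists2 c, c \in `[a, b] & f b - f a = df c * (b - a).
Proof.
move=> dfd ab; apply: MVT_segment => //.
by apply: derivable_within_continuous => t _; case: (dfd t).
Qed.

Lemma lipschitz_of_derive (f df : R -> R) (k s t : R) :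
    (forall u : R, is_derive u 1 f (df u)) -> (forall u, `|df u| <= k) ->
  `|f s - f t| <= k * `|s - t|.
Proof.
move=> dfd dfk; wlog ts : s t / t <= s.
  move=> H; case/orP: (le_total t s) => [|st]; first exact: H.
  by rewrite distrC (distrC s); exact: H.
have [c _ ->] := mvt_global dfd ts.
by rewrite normrM ler_wpM2r.
Qed.

(** The function acos \o h would be k-Lipschitz by the bound on dh, but acos is
    not differentiable at 1 = h c.  Scaling h by cos d < 1 keeps the values
    inside ]-1, 1[ and preserves the bound on the derivative; then
    acos (cos d * h) starts at d and grows with slope at most k. *)
Lemma damped_cos_le (h dh : R -> R) (k c t d : R) :
    0 < k -> (forall u : R, is_derive u 1 h (dh u)) -> h c = 1 ->
    (forall u, dh u ^+ 2 <= k ^+ 2 * (1 - h u ^+ 2)) ->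
    0 < d < pi -> d + k * `|t - c| <= pi ->
  cos (d + k * `|t - c|) <= cos d * h t.
Proof.
move=> k0 dhd hc dhle /andP[d0 dpi] dtpi.
have cosd1 : `|cos d| < 1.
  rewrite ltr_norml -cospi -[X in _ && (_ < X)]cos0.
  by rewrite !ltr_cos ?in_itv /= ?lexx ?pi_ge0 ?dpi ?(ltW dpi) ?(ltW d0).
have sqr_le1 u : h u ^+ 2 <= 1.
  rewrite -subr_ge0 -(@pmulr_rge0 _ (k ^+ 2)) ?exprn_gt0 //.
  exact: le_trans (sqr_ge0 _) (dhle u).
have lt1 u : -1 < cos d * h u < 1.
  rewrite -ltr_norml normrM; apply: le_lt_trans cosd1.
  by rewrite ler_piMr // -(@expr_le1 _ 2) // real_normK ?num_real.
have le1 u : -1 <= cos d * h u <= 1.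
  by have /andP[/ltW -> /ltW ->] := lt1 u.
pose g u := acos (cos d * h u).
pose dg u := - (Num.sqrt (1 - (cos d * h u) ^+ 2))^-1 * (cos d * dh u).
have dgd (u : R) : is_derive u 1 g (dg u).
  have dch : is_derive u 1 (fun v => cos d * h v) (cos d * dh u).
    exact: is_deriveZ.
  have := @is_derive1_comp _ _ _ u _ _ (is_derive1_acos (lt1 u)) dch.
  by [].
have dgk u : `|dg u| <= k.
  have s0 : 0 < 1 - (cos d * h u) ^+ 2.
    by rewrite subr_gt0 -real_normK ?num_real // expr_lt1 // ltr_norml.
  rewrite normrM normrN normfV mulrC.
  rewrite ler_pdivrMr ?normr_gt0 ?gt_eqF ?sqrtr_gt0 //.
  rewrite [`|Num.sqrt _|]ger0_norm ?sqrtr_ge0 //.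
  rewrite -sqrtr_sqr -[k in leRHS]gtr0_norm // -sqrtr_sqr.
  rewrite -sqrtrM ?sqr_ge0 // ler_wsqrtr //.
  have c1 : cos d ^+ 2 <= 1.
    by rewrite -real_normK ?num_real // expr_le1 // ltW.
  have := dhle u; have k2 : 0 < k ^+ 2 by exact: exprn_gt0.
  rewrite !exprMn; nra.
have gc : g c = d by rewrite /g hc mulr1 cosK // in_itv /= !ltW.
have gt : g t <= d + k * `|t - c|.
  have := lipschitz_of_derive t c dgd dgk; rewrite gc.
  by move/(le_trans (ler_norm _)); rewrite lerBlDl.
have <- : cos (g t) = cos d * h t by rewrite acosK // in_itv /= le1.
rewrite leNgt ltr_cos -?leNgt //.
- by rewrite in_itv /= dtpi addr_ge0 ?mulr_ge0 ?(ltW d0) ?(ltW k0).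
- by rewrite in_itv /= acos_ge0 ?acos_lepi.
Qed.

(** The limit of [damped_cos_le] as d tends to 0 from the right. *)
Lemma cos_comparison (h dh : R -> R) (k c t : R) :
    0 < k -> (forall u : R, is_derive u 1 h (dh u)) -> h c = 1 ->
    (forall u, dh u ^+ 2 <= k ^+ 2 * (1 - h u ^+ 2)) ->
    k * `|t - c| < pi ->
  cos (k * `|t - c|) <= h t.
Proof.
move=> k0 dhd hc dhle tpi; set a := k * `|t - c| in tpi *.
have lim_l : cos (d + a) @[d --> (0:R)^'+] --> cos (0 + a).
  apply: cvg_at_right_filter.
  apply: continuous_comp; last exact: continuous_cos.
  by apply: cvgD; [exact: cvg_id|exact: cvg_cst].
have lim_r : cos d * h t @[d --> (0:R)^'+] --> cos 0 * h t.
  by apply: cvg_at_right_filter; apply: cvgMr_tmp; exact: continuous_cos.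
rewrite add0r in lim_l; rewrite cos0 mul1r in lim_r.
apply: ler_cvg_to lim_l lim_r _; near=> d.
apply: (damped_cos_le k0 dhd hc dhle).
  apply/andP; split; first by near: d; exact: nbhs_right_gt.
  by near: d; apply: nbhs_right_lt; exact: pi_gt0.
by rewrite -lerBrDr; near: d; apply: nbhs_right_le; rewrite subr_gt0.
Unshelve. all: by end_near. Qed.

End Comparison.

(** * Loops of curves with bounded curvature, and linear flows *)

Section Loops.
Context {R : realType} (n p : nat).
Implicit Types F G : R -> 'M[R]_(n, p).

Lemma frob_cst_orth F (F' : 'M[R]_(n, p)) (N t : R) :
  is_derive t 1 F F' -> (forall s, frob (F s) (F s) = N) -> frob (F t) F' = 0.
Proof.
move=> dF FN; have [_] := is_derive_frob dF dF.
rewrite (_ : (fun _ => _) = cst N); last by apply/funext.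
by rewrite derive_cst (frobC F') => h; lra.
Qed.

(** The case of Schur's comparison theorem where the model is a circle of
    curvature k.  Here h is the cosine of the angle between the tangent and the
    tangent e at the midpoint; it dominates cos (k (t - c)), and integrating
    N (h - cos (k (t - c))) shows that the product of the displacement with e is
    at least 2 (N / k) sin (k T / 2) > 0. *)
Lemma bounded_curvature_no_loop (F F1 F2 : R -> 'M[R]_(n, p)) (N k T : R) :
    (forall t : R, is_derive t 1 F (F1 t)) ->
    (forall t : R, is_derive t 1 F1 (F2 t)) ->
    (forall t, frob (F1 t) (F1 t) = N) ->
    (forall t, frob (F2 t) (F2 t) <= k ^+ 2 * N) ->
    0 < N -> 0 < k -> 0 < T -> k * T < 2 * pi ->
  F T <> F 0.
Proof.
move=> dF dF1 F1N F2k N0 k0 T0 kTpi FT.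
have F12 t : frob (F1 t) (F2 t) = 0 by exact: frob_cst_orth (dF1 t) F1N.
pose c := T / 2; pose e := F1 c.
have de t := is_derive_cst e t (1 : R).
pose h t := frob (F1 t) e / N; pose dh t := frob (F2 t) e / N.
have dhd (t : R) : is_derive t 1 h (dh t).
  have := is_deriveZ N^-1 (is_derive_frob (dF1 t) (de t)).
  rewrite frob0r addr0 [_ *: _]mulrC => d.
  rewrite (_ : h = N^-1 \*: (fun s => frob (F1 s) e)) //.
  by apply/funext => s; rewrite /h /= mulrC.
have hc : h c = 1 by rewrite /h F1N divff ?gt_eqF.
have dhle t : dh t ^+ 2 <= k ^+ 2 * (1 - h t ^+ 2).
  (* F2 t is orthogonal to F1 t, hence pairs with w as it does with e *)
  pose w := e - h t *: F1 t.
  have fE : frob (F1 t) e = h t * N by rewrite /h divfK ?gt_eqF.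
  have ww : frob w w = N * (1 - h t ^+ 2).
    rewrite !(frobBl, frobBr, frobZl, frobZr) (frobC e (F1 t)) !F1N fE; ring.
  have w0 : 0 <= N * (1 - h t ^+ 2) by rewrite -ww frob_ge0.
  have -> : dh t ^+ 2 = frob (F2 t) w ^+ 2 / N ^+ 2.
    by rewrite frobBr frobZr (frobC _ (F1 t)) F12 mulr0 subr0 /dh expr_div_n.
  rewrite ler_pdivrMr ?exprn_gt0 //; apply: le_trans (frob_CS _ _) _.
  rewrite ww; apply: le_trans (ler_wpM2r w0 (F2k t)) _.
  by rewrite le_eqVlt; apply/orP; left; apply/eqP; ring.
pose K t := frob (F t) e - N / k * sin (k * (t - c)).
pose dK t := N * (h t - cos (k * (t - c))).
have dKd (t : R) : is_derive t 1 K (dK t).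
  have dlin : is_derive t 1 (fun s : R => k * (s - c)) k.
    have := is_deriveZ k
      (is_deriveB (is_derive_id t (1 : R)) (is_derive_cst c t 1)).
    by rewrite subr0 [_ *: _]mulr1.
  have dsin := is_deriveZ (N / k) (is_derive1_comp (is_derive_sin _) dlin).
  have := is_deriveB (is_derive_frob (dF t) (de t)) dsin.
  rewrite frob0r addr0.
  move/is_derive_eq; apply.
  rewrite /dK /h /GRing.scale /=; field.
  by rewrite !gt_eqF.
have [x xT] := mvt_global dKd (ltW T0).
have xlt : k * `|x - c| < pi.
  have xc : `|x - c| <= T / 2.
    move: xT; rewrite in_itv /= ler_norml /c => /andP[? ?].
    by apply/andP; split; lra.
  have := ler_wpM2l (ltW k0) xc; lra.
have : 0 <= dK x * (T - 0).
  rewrite mulr_ge0 ?subr0 ?(ltW T0) // mulr_ge0 ?(ltW N0) // subr_ge0.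
  have := cos_comparison k0 dhd hc dhle xlt.
  by have [_|_] := ger0P (x - c); rewrite // mulrN cosN.
move=> + dKE; rewrite -dKE /K FT /c sub0r.
have -> : T - T / 2 = T / 2 by field.
rewrite mulrN sinN.
have sin0 : 0 < sin (k * (T / 2)).
  by rewrite sin_gt0_pi // mulr_gt0 ?divr_gt0 //=; lra.
have := mulr_gt0 (divr_gt0 N0 k0) sin0.
lra.
Qed.

Section Flow.
Variables (M : 'M[R]_n) (C : 'M[R]_p).
Hypotheses (skM : M^T = - M) (skC : C^T = - C).

Definition flow_field (X : 'M[R]_(n, p)) : 'M[R]_(n, p) := M *m X - X *m C.

Definition is_flow (F : R -> 'M[R]_(n, p)) :=
  forall t : R, is_derive t 1 F (flow_field (F t)).

Lemma flow_fieldD X Y : flow_field (X + Y) = flow_field X + flow_field Y.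
Proof. by rewrite /flow_field mulmxDr mulmxDl opprD addrACA. Qed.

Lemma flow_fieldZ a X : flow_field (a *: X) = a *: flow_field X.
Proof. by rewrite /flow_field -scalemxAr -scalemxAl scalerBr. Qed.

Lemma flow_field_skew X Y :
  frob (flow_field X) Y = - frob X (flow_field Y).
Proof.
rewrite /flow_field frobBl frobBr frob_mull frob_mulr skM skC.
by rewrite mulNmx mulmxN !frobNr opprB opprK addrC.
Qed.

Lemma is_flow_field F : is_flow F -> is_flow (flow_field \o F).
Proof.
move=> dF t; apply: is_derive_eq.
  apply: is_deriveB.
    exact: is_derive_cst_mulmx (dF t).
  exact: is_derive_mulmx_cst (dF t).
by [].
Qed.

Lemma is_flowB F G : is_flow F -> is_flow G -> is_flow (fun t => F t - G t).
Proof.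
move=> dF dG t; rewrite -scaleN1r flow_fieldD flow_fieldZ scaleN1r.
exact: is_deriveB.
Qed.

Lemma flow_frob_cst F : is_flow F ->
  forall t, frob (F t) (F t) = frob (F 0) (F 0).
Proof.
move=> dF t; apply: (@is_derive_0_is_cst _ (fun s => frob (F s) (F s))) => s.
have := is_derive_frob (dF s) (dF s).
by rewrite flow_field_skew addNr.
Qed.

(** The difference of two solutions has constant norm, because the field is
    skew. *)
Lemma flow_unique F G : is_flow F -> is_flow G -> F 0 = G 0 -> F =1 G.
Proof.
move=> dF dG FG0 t; apply/subr0_eq/frob_eq0.
by rewrite (flow_frob_cst (is_flowB dF dG)) FG0 subrr frob0r.
Qed.

(** Velocity and acceleration of a solution are again solutions, so their norms
    are constant and [bounded_curvature_no_loop] applies with any k between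
    |F''| / |F'| and 2 pi / T. *)
Lemma flow_loop F T : is_flow F -> 0 < T -> F T = F 0 ->
  (2 * pi / T) ^+ 2 * frob (flow_field (F 0)) (flow_field (F 0)) <=
  frob (flow_field (flow_field (F 0))) (flow_field (flow_field (F 0))).
Proof.
move=> dF T0 FT; have dF1 := is_flow_field dF; have dF2 := is_flow_field dF1.
set N := frob (flow_field (F 0)) _; set N2 := frob _ _.
have N20 : 0 <= N2 by exact: frob_ge0.
have pi0 := pi_gt0 R.
have [N0|Nn0] := eqVneq N 0; first by rewrite N0 mulr0.
have N0 : 0 < N by rewrite lt0r Nn0 frob_ge0.
rewrite leNgt; apply/negP => N2lt.
(* the midpoint makes k positive also when the acceleration vanishes *)
pose k2 := (N2 / N + (2 * pi / T) ^+ 2) / 2; pose k := Num.sqrt k2.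
have k2_lt : N2 / N < k2 < (2 * pi / T) ^+ 2.
  have : N2 / N < (2 * pi / T) ^+ 2 by rewrite ltr_pdivrMr.
  rewrite /k2; lra.
have k20 : 0 < k2.
  by case/andP: k2_lt => + _; apply: le_lt_trans; rewrite divr_ge0 // ltW.
have kE : k ^+ 2 = k2 by rewrite sqr_sqrtr // ltW.
apply: (@bounded_curvature_no_loop F _ _ N k T dF dF1) => //.
- by move=> t; exact: (flow_frob_cst dF1).
- move=> t; rewrite [leLHS](flow_frob_cst dF2) kE -/N2.
  by rewrite -ler_pdivrMr // ltW; case/andP: k2_lt.
- by rewrite sqrtr_gt0.
rewrite -ltr_pdivlMr // -(@ltr_pXn2r _ 2) // ?nnegrE ?sqrtr_ge0 //.
  by rewrite kE; case/andP: k2_lt.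
by rewrite divr_ge0 ?mulr_ge0 // ltW.
Qed.

End Flow.
End Loops.

(** * Orthonormal completions *)

Section Completion.
Context {R : realType}.

(** W has fewer than n columns, so its row kernel is nonzero. *)
Lemma unit_vector_orth n k (W : 'M[R]_(n, k)) : (k < n)%N ->
  exists2 x : 'cV[R]_n, x^T *m x = 1%:M & W^T *m x = 0.
Proof.
move=> kn; have : kermx W != 0.
  rewrite -mxrank_eq0 mxrank_ker -lt0n subn_gt0.
  exact: leq_ltn_trans (rank_leq_col W) kn.
case/rowV0Pn => v /sub_kermxP vW v0.
have vv0 : 0 < frob v v.
  by rewrite lt0r frob_ge0 andbT; apply: contra_neq v0; exact: frob_eq0.
exists ((Num.sqrt (frob v v))^-1 *: v)^T; last first.
  by rewrite -trmx_mul -scalemxAl vW scaler0 trmx0.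
rewrite trmxK mul_row_tr frobZl frobZr mulrA -expr2 exprVn sqr_sqrtr ?ltW //.
by rewrite mulVf // gt_eqF.
Qed.

Lemma orthonormal_extension n p m (U : 'M[R]_(n, p)) : (p + m <= n)%N ->
  exists2 V : 'M[R]_(n, m), V^T *m V = 1%:M & U^T *m V = 0.
Proof.
elim: m => [|m IHm] pmn.
  by exists 0; [rewrite mulmx0; apply/matrixP => -[] | rewrite mulmx0].
have [V VV UV] : exists2 V : 'M[R]_(n, m), V^T *m V = 1%:M & U^T *m V = 0.
  by apply: IHm; lia.
have [x xx Wx] := @unit_vector_orth n (p + m) (row_mx U V) ltac:(lia).
move: Wx; rewrite tr_row_mx mul_col_mx -[0](@col_mx0 R p m 1).
case/eq_col_mx => Ux Vx.
suff : exists2 V' : 'M[R]_(n, 1 + m), V'^T *m V' = 1%:M & U^T *m V' = 0 by [].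
exists (row_mx x V).
  rewrite tr_row_mx mul_col_row xx VV Vx -[x^T *m V]trmxK trmx_mul trmxK Vx.
  by rewrite trmx0 -scalar_mx_block.
by rewrite mul_mx_row Ux UV row_mx0.
Qed.

Lemma orthogonal_square n k (W : 'M[R]_(n, k)) : k = n ->
  W^T *m W = 1%:M -> W *m W^T = 1%:M.
Proof. by move=> kn; case: n / kn W => W; exact: mulmx1C. Qed.

(** Extending U by n - p orthonormal columns gives a completion, so the choice
    made by [perp] is one. *)
Lemma perpP n p (U : 'M[R]_(n, p)) : (p <= n)%N -> stiefel U ->
  orthogonal_completion U (perp U).
Proof.
move=> pn UU; apply: xgetPex.
have [V VV UV] := @orthonormal_extension n p (n - p) U ltac:(lia).
have orth : (row_mx U V)^T *m row_mx U V = 1%:M.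
  rewrite tr_row_mx mul_col_row UU VV UV -[V^T *m U]trmxK trmx_mul trmxK UV.
  by rewrite trmx0 -scalar_mx_block.
by exists V; split=> //; apply: orthogonal_square orth; rewrite subnKC.
Qed.

(** Expresses the B-part of the beta-metric through the Frobenius norm and the
    A-part alone, which removes the choice of [perp] at moving base points. *)
Lemma frob_coord n p (U D : 'M[R]_(n, p)) : (p <= n)%N -> stiefel U ->
  frob D D = frob (coordA U D) (coordA U D) + frob (coordB U D) (coordB U D).
Proof.
move=> pn UU; have [_ WW] := perpP pn UU.
rewrite -frob_col_mx /coordA /coordB -mul_col_mx -tr_row_mx.
by rewrite frob_mull trmxK mulmxA WW mul1mx.
Qed.

End Completion.

(** * Geodesics through the base point *)

(** The derivative of F^T F along F = expm (s *: X) is F^T (X^T + X) F = 0. *)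
Lemma expm_skew_orth (R : realType) n (X : 'M[R]_n) (t : R) : X^T = - X ->
  (expm (t *: X))^T *m expm (t *: X) = 1%:M.
Proof.
move=> skX; pose F s := expm (s *: X).
have dF (s : R) : is_derive s 1 F (X *m F s) by exact: is_derive_expm.
have dFF (s : R) := is_derive_mulmx (is_derive_trmx (dF s)) (dF s).
have FF0 : (F 0)^T *m F 0 = 1%:M by rewrite /F scale0r expm0 trmx1 mulmx1.
rewrite -FF0; apply/matrixP => i j.
apply: (@is_derive_0_is_cst _ (fun s => ((F s)^T *m F s) i j)) => s.
have := (is_derive_mxP _ _ _).1 (dFF s) i j.
by rewrite trmx_mul skX mulmxN mulNmx -mulmxA addNr mxE.
Qed.

Section CanonicalGeodesic.
Context {R : realType} (p q : nat) (beta : R).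
Variables (A : 'M[R]_p) (B : 'M[R]_(q, p)).
Hypothesis skA : A^T = - A.

(** The matrices M, C, J and the curve G of the introductory comment are
    [lgen], [rgen], [base_pt] and [base_geo]. *)
Definition lgen : 'M[R]_(p + q) := block_mx ((2 * beta) *: A) (- B^T) B 0.
Definition rgen : 'M[R]_p := (2 * beta - 1) *: A.
Definition base_pt : 'M[R]_(p + q, p) := col_mx 1%:M 0.
Definition base_geo (t : R) : 'M[R]_(p + q, p) :=
  expm (t *: lgen) *m base_pt *m expm ((t * (1 - 2 * beta)) *: A).

Lemma lgen_skew : lgen^T = - lgen.
Proof.
rewrite /lgen tr_block_mx opp_block_mx !linearN !linearZ /= skA trmxK trmx0.
by rewrite scalerN oppr0 opprK.
Qed.

Lemma rgen_skew : rgen^T = - rgen.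
Proof. by rewrite /rgen linearZ /= skA scalerN. Qed.

Lemma base_geo_flow : is_flow lgen rgen base_geo.
Proof.
move=> t; have d1 := is_derive_mulmx_cst base_pt (is_derive_expm lgen t).
have := is_derive_expm ((1 - 2 * beta) *: A) t.
have eE s :
  expm (s *: ((1 - 2 * beta) *: A)) = expm ((s * (1 - 2 * beta)) *: A).
  by rewrite scalerA.
rewrite (_ : (fun _ => _) = fun s => expm ((s * (1 - 2 * beta)) *: A));
  last by apply/funext.
rewrite eE -scalemxAl expm_comm scalemxAr => d2.
apply: is_derive_eq; first exact: is_derive_mulmx d1 d2.
rewrite /flow_field /base_geo !mulmxA; congr (_ + _).
by rewrite -mulmxN; congr (_ *m _); rewrite /rgen -[RHS]scaleNr opprB.
Qed.

Lemma base_geo0 : base_geo 0 = base_pt.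
Proof. by rewrite /base_geo mul0r !scale0r !expm0 mulmx1 mul1mx. Qed.

Lemma base_pt_stiefel : base_pt^T *m base_pt = 1%:M.
Proof. by rewrite /base_pt tr_col_mx mul_row_col trmx1 mulmx1 mulmx0 addr0. Qed.

Lemma base_geo_stiefel t : (base_geo t)^T *m base_geo t = 1%:M.
Proof.
rewrite /base_geo !trmx_mul !mulmxA.
rewrite -[X in X *m base_pt]mulmxA expm_skew_orth; last exact: lgen_skew.
rewrite mulmx1 -[X in X *m expm _]mulmxA base_pt_stiefel mulmx1.
exact: expm_skew_orth.
Qed.

(** The conserved quantity of the geodesic: M and C commute with the respective
    exponentials, which are orthogonal, so the product reduces to its value
    2 beta A - C at time 0. *)
Lemma base_geo_velocityA t :
  (base_geo t)^T *m flow_field lgen rgen (base_geo t) = A.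
Proof.
rewrite /flow_field mulmxBr [_ *m (_ *m rgen)]mulmxA base_geo_stiefel mul1mx.
rewrite /base_geo; set P := expm (t *: lgen); set Q := expm (_ *: A).
have PP : P^T *m P = 1%:M by exact: expm_skew_orth lgen_skew.
have QQ : Q^T *m Q = 1%:M by exact: expm_skew_orth.
have MP : lgen *m P = P *m lgen by exact: expm_comm.
have AQ : A *m Q = Q *m A by exact: expm_comm.
have -> : (P *m base_pt *m Q)^T *m (lgen *m (P *m base_pt *m Q)) =
    Q^T *m (base_pt^T *m (lgen *m base_pt)) *m Q.
  rewrite !trmx_mul -!mulmxA (mulmxA lgen P) MP.
  by rewrite -!mulmxA (mulmxA P^T P) PP mul1mx.
have -> : base_pt^T *m (lgen *m base_pt) = (2 * beta) *: A.
  rewrite /base_pt /lgen tr_col_mx mul_block_col mul_row_col.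
  by rewrite trmx1 trmx0 !mulmx0 mul0mx mulmx1 mul1mx !addr0.
rewrite -scalemxAr -scalemxAl -mulmxA AQ mulmxA QQ mul1mx /rgen -scalerBl.
by rewrite opprB addrCA subrr addr0 scale1r.
Qed.

Lemma flow_field_J : flow_field lgen rgen base_pt = col_mx A B.
Proof.
rewrite /flow_field /lgen /base_pt mul_block_col mul_col_mx.
rewrite !mulmx0 !mulmx1 !addr0 mul1mx mul0mx opp_col_mx add_col_mx.
rewrite subr0 -scalerBl.
by rewrite opprB addrCA subrr addr0 scale1r.
Qed.

Lemma flow_field2_J : flow_field lgen rgen (col_mx A B) =
  col_mx (A *m A - B^T *m B) ((2 * (1 - beta)) *: (B *m A)).
Proof.
rewrite /flow_field /lgen /rgen mul_block_col mul_col_mx mul0mx addr0 mulNmx.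
rewrite opp_col_mx add_col_mx -scalemxAl -!scalemxAr; congr col_mx.
  by rewrite addrAC -scalerBl opprB addrCA subrr addr0 scale1r.
by rewrite -{1}[B *m A]scale1r -scalerBl; congr (_ *: _); ring.
Qed.

Lemma base_geo_speed t :
  frob (flow_field lgen rgen (base_geo t)) (flow_field lgen rgen (base_geo t)) =
  frob A A + frob B B.
Proof.
rewrite (flow_frob_cst lgen_skew rgen_skew (is_flow_field base_geo_flow)).
by rewrite /= base_geo0 flow_field_J frob_col_mx.
Qed.

Lemma base_geo_loop_ge T : 0 < beta -> beta <= 2 -> 0 < T ->
    base_geo T = base_geo 0 -> A != 0 \/ B != 0 ->
  Num.min (2 * beta) 1 * (2 * pi / T) ^+ 2 <= beta * frob A A + frob B B.
Proof.
move=> be0 be2 T0 GT AB.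
have ab0 : 0 < frob A A + frob B B.
  have fgt0 m n (X : 'M[R]_(m, n)) : X != 0 -> 0 < frob X X.
    move=> X0; rewrite lt0r frob_ge0 andbT.
    by apply: contra_neq X0; exact: frob_eq0.
  by case: AB => /fgt0 ?; [rewrite ltr_wpDr|rewrite ltr_wpDl] => //;
    exact: frob_ge0.
have := flow_loop lgen_skew rgen_skew base_geo_flow T0 GT.
rewrite base_geo0 flow_field_J flow_field2_J !frob_col_mx => loop_le.
have min0 : 0 <= Num.min (2 * beta) 1 by rewrite le_min ler01 mulr_ge0 // ltW.
have := le_trans (ler_wpM2l min0 loop_le) (accel_le B be0 be2 skA).
by rewrite mulrA mulrC ler_pM2l.
Qed.

Lemma base_geo_cst t : A = 0 -> B = 0 -> base_geo t = base_geo 0.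
Proof.
move=> A0 B0; rewrite base_geo0 /base_geo /lgen A0 B0 !scaler0 trmx0 oppr0.
by rewrite block_mx0 scaler0 !expm0 mulmx1 mul1mx.
Qed.

(** Since N^3 = - N, the right-hand side has derivative w N times itself; it is
    a solution of the same linear equation because left multiplication by N
    commutes with the field, whose value at the base point is w N J. *)
Lemma base_geo_rodrigues (N : 'M[R]_(p + q)) (w : R) :
    N *m N *m N = - N -> lgen *m N = N *m lgen ->
    col_mx A B = w *: (N *m base_pt) ->
  forall t, base_geo t = base_pt + sin (w * t) *: (N *m base_pt)
    + (1 - cos (w * t)) *: (N *m N *m base_pt).
Proof.
move=> N3 MN ABN; pose H t := base_pt + sin (w * t) *: (N *m base_pt)
    + (1 - cos (w * t)) *: (N *m N *m base_pt).
apply: (flow_unique lgen_skew rgen_skew base_geo_flow (G := H)); last first.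
    by rewrite /H base_geo0 mulr0 sin0 cos0 subrr !scale0r !addr0.
have fN X : flow_field lgen rgen (N *m X) = N *m flow_field lgen rgen X.
  by rewrite /flow_field mulmxBr !mulmxA MN.
have fJ : flow_field lgen rgen base_pt = w *: (N *m base_pt).
  by rewrite flow_field_J.
move=> t.
have dw : is_derive t 1 (fun s : R => w * s) w.
  by have := is_deriveZ w (is_derive_id t (1 : R)); rewrite [_ *: _]mulr1.
have dsin := is_derive1_comp (is_derive_sin _) dw.
have dcos := is_deriveB (is_derive_cst (1 : R) t 1)
  (is_derive1_comp (is_derive_cos _) dw).
have dH := is_deriveD (is_deriveD (is_derive_cst base_pt t (1 : R))
  (is_derive_scale_cst (N *m base_pt) dsin))
  (is_derive_scale_cst (N *m N *m base_pt) dcos).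
apply: (is_derive_eq dH).
rewrite !flow_fieldD !flow_fieldZ -!mulmxA !fN fJ -!scalemxAr !mulmxA N3 mulNmx.
move: (N *m base_pt) (N *m N *m base_pt) => X Y.
by apply/matrixP => i j; rewrite !mxE; ring.
Qed.

End CanonicalGeodesic.

(** * Geodesics through an arbitrary point and their lengths *)

Section Geodesics.
Context {R : realType} (n p : nat) (beta : R) (U D : 'M[R]_(n, p)).
Hypotheses (pn : (p <= n)%N) (UU : stiefel U) (tD : tangent U D).
Let A := coordA U D.
Let B := coordB U D.
Let W := row_mx U (perp U).
Let G := base_geo beta A B.

Lemma geodesicE t : geodesic beta U D t = W *m G t.
Proof. by rewrite /geodesic /G /base_geo !mulmxA. Qed.

Lemma frameK m (X : 'M[R]_(p + (n - p), m)) : W^T *m (W *m X) = X.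
Proof. by have [WW _] := perpP pn UU; rewrite mulmxA WW mul1mx. Qed.

Lemma geodesic_eq s t :
  (geodesic beta U D s = geodesic beta U D t) <-> (G s = G t).
Proof.
rewrite !geodesicE; split=> [WG|-> //].
by rewrite -[G s]frameK WG frameK.
Qed.

Lemma geodesic_stiefel t : stiefel (geodesic beta U D t).
Proof.
rewrite /stiefel /= geodesicE trmx_mul -mulmxA frameK.
exact: base_geo_stiefel.
Qed.

Lemma derive1_geodesic t : derive1 (geodesic beta U D) t =
  W *m flow_field (lgen beta A B) (rgen beta A) (G t).
Proof.
rewrite (_ : geodesic beta U D = fun s => W *m G s).
  rewrite derive1E.
  by have [] := is_derive_cst_mulmx W (base_geo_flow beta A B t).
by apply/funext => s; exact: geodesicE.
Qed.

(** With c = W G, the A-part is constant and so is |c'|^2 = a + b; by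
    [frob_coord] the B-part then has constant norm b. *)
Lemma geodesic_speed t : let c := geodesic beta U D in
  beta_metric beta (c t) (derive1 c t) (derive1 c t) =
  beta * frob A A + frob B B.
Proof.
move=> c; rewrite /beta_metric.
have cA : coordA (c t) (derive1 c t) = A.
  rewrite /coordA derive1_geodesic /c geodesicE trmx_mul -mulmxA frameK.
  exact: base_geo_velocityA.
have := frob_coord (derive1 c t) pn (geodesic_stiefel t).
rewrite -/(c t) cA [LHS](_ : _ = frob A A + frob B B); last first.
  by rewrite derive1_geodesic frob_mull frameK base_geo_speed.
move/addrI => BB.
by rewrite -/(frob A A) -/(frob (coordB (c t) _) _) BB.
Qed.

Lemma geodesic_length T : 0 <= T ->
  beta_length beta (geodesic beta U D) 0 T =
  Num.sqrt (beta * frob A A + frob B B) * T.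
Proof.
move=> T0; rewrite /beta_length.
under eq_Rintegral do rewrite geodesic_speed.
rewrite Rintegral_cst //= lebesgue_measure_itv /= lte_fin.
case: ltgtP T0 => //= [T0 _|<-]; last by [].
by rewrite subr0.
Qed.

Lemma geodesic_loop_length_ge T : 0 < beta -> beta <= 2 ->
  geodesic_loop beta U D T ->
  Num.min (Num.sqrt (2 * beta)) 1 * (2 * pi) <=
  beta_length beta (geodesic beta U D) 0 T.
Proof.
move=> be0 be2 [_ _ T0 /geodesic_eq GT [t _ ncst]].
rewrite geodesic_length; last exact: ltW.
have AB : A != 0 \/ B != 0.
  have [A0|An0] := eqVneq A 0; last by left.
  have [B0|Bn0] := eqVneq B 0; last by right.
  by case: ncst; apply/geodesic_eq; exact: base_geo_cst.
have le := base_geo_loop_ge tD be0 be2 T0 GT AB.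
have piT0 : 0 <= 2 * pi / T by rewrite divr_ge0 ?mulr_ge0 ?pi_ge0 // ltW.
have min0 : 0 <= Num.min (2 * beta) 1 by rewrite le_min ler01 mulr_ge0 // ltW.
have -> : Num.min (Num.sqrt (2 * beta)) 1 = Num.sqrt (Num.min (2 * beta) 1).
  have b20 : 0 <= 2 * beta by rewrite mulr_ge0 // ltW.
  have [le1|gt1] := leP (2 * beta) 1.
    by rewrite min_l // -[leRHS]sqrtr1 ler_wsqrtr.
  by rewrite min_r ?sqrtr1 // -[leLHS]sqrtr1 ler_wsqrtr // ltW.
rewrite -ler_pdivrMr // -mulrA -[2 * pi / T]ger0_norm // -sqrtr_sqr -sqrtrM //.
exact: ler_wsqrtr.
Qed.

End Geodesics.

(** * Loops of minimal length *)

Lemma frob_delta (R : realType) m n (i : 'I_m) (j : 'I_n) (X : 'M[R]_(m, n)) :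
  frob (delta_mx i j) X = X i j.
Proof.
rewrite frobE (bigD1 i) //= (bigD1 j) //= mxE !eqxx mul1r big1 => [|j' j'j].
  rewrite addr0 big1 ?addr0 // => i' i'i; rewrite big1 // => j' _.
  by rewrite mxE (negPf i'i) mul0r.
by rewrite mxE (negPf j'j) andbF mul0r.
Qed.

Section Witnesses.
Context {R : realType} (n p : nat) (beta : R).
Hypothesis pn : (p <= n)%N.

(** The geodesic closes up at time 1, and at time 1/2 it is at J + 2 N^2 J,
    which differs from J. *)
Lemma rodrigues_loop_length (A : 'M[R]_p) (B : 'M[R]_(n - p, p))
    (N : 'M[R]_(p + (n - p))) :
    A^T = - A -> N *m N *m N = - N ->
    lgen beta A B *m N = N *m lgen beta A B ->
    col_mx A B = (2 * pi) *: (N *m base_pt p (n - p)) ->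
    N *m N *m base_pt p (n - p) != 0 ->
  loop_lengths n p beta (Num.sqrt (beta * frob A A + frob B B)).
Proof.
move=> skA N3 MN ABN NNJ.
have [U UU _] := @orthonormal_extension R n 0 p 0 pn.
pose D := row_mx U (perp U) *m col_mx A B.
have WD : (row_mx U (perp U))^T *m D = col_mx A B by rewrite /D frameK.
have [AE BE] : coordA U D = A /\ coordB U D = B.
  by apply: eq_col_mx; rewrite -WD tr_row_mx mul_col_mx.
have tD : tangent U D by rewrite /tangent /= -/(coordA U D) AE.
have GE := base_geo_rodrigues skA N3 MN ABN.
exists U, D, 1; split; last first.
  by rewrite geodesic_length // AE BE mulr1.
split=> //.
  apply/geodesic_eq => //; rewrite AE BE !GE mulr1 mulr0.
  by rewrite mulrC mulr_natr sin2pi cos2pi sin0 cos0.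
exists 2^-1; first by rewrite in_itv /=; lra.
move/geodesic_eq => /(_ pn UU); rewrite AE BE !GE mulr0 mulrAC divff // mul1r.
rewrite sin0 cos0 subrr !scale0r !addr0 sinpi cospi scale0r addr0 opprK.
move/eqP; rewrite -subr_eq0 addrAC subrr add0r scaler_eq0 (negPf NNJ) orbF.
by rewrite -[1 + 1]/(2%:R) pnatr_eq0.
Qed.

(** A rotates the plane of the first two coordinates and B = 0. *)
Lemma rotation_loop : 0 <= beta -> (2 <= p)%N ->
  loop_lengths n p beta (Num.sqrt (2 * beta) * (2 * pi)).
Proof.
move=> be0 p2; pose i : 'I_p := Ordinal (ltnW p2); pose j : 'I_p := Ordinal p2.
have ij : i != j by [].
pose K : 'M[R]_p := delta_mx i j - delta_mx j i.
have skK : K^T = - K by rewrite /K linearB /= !trmx_delta opprB.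
have KK : K *m K = - (delta_mx i i + delta_mx j j).
  rewrite /K mulmxBl !mulmxBr !mul_delta_mx !mul_delta_mx_0 // 1?eq_sym //.
  by rewrite sub0r subr0 opprD.
have K3 : K *m K *m K = - K.
  rewrite KK mulNmx /K mulmxDl !mulmxBr !mul_delta_mx.
  rewrite !mul_delta_mx_0 // 1?eq_sym //.
  by rewrite subr0 sub0r.
have KKf : frob K K = 2.
  rewrite {1}/K frobBl !frob_delta /K !mxE !eqxx (negPf ij) andbF /=.
  by rewrite subr0 sub0r opprK.
pose A := (2 * pi) *: K.
have skA : A^T = - A by rewrite /A linearZ /= skK scalerN.
pose N : 'M[R]_(p + (n - p)) := block_mx K 0 0 0.
have -> : Num.sqrt (2 * beta) * (2 * pi) =
    Num.sqrt (beta * frob A A + frob (0 : 'M[R]_(n - p, p)) 0).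
  rewrite frob0r addr0 /A frobZl frobZr KKf.
  have -> : beta * (2 * pi * (2 * pi * 2)) = 2 * beta * (2 * pi) ^+ 2 by ring.
  by rewrite [RHS]sqrtrM ?mulr_ge0 // sqrtr_sqr ger0_norm // mulr_ge0 // pi_ge0.
apply: (@rodrigues_loop_length A 0 N) => //.
- by rewrite /N !mulmx_block !(mul0mx, mulmx0, addr0) K3 opp_block_mx !oppr0.
- rewrite /N /lgen trmx0 oppr0 !mulmx_block !(mul0mx, mulmx0, addr0).
  by rewrite /A -!scalemxAl -!scalemxAr.
- rewrite /N /base_pt mul_block_col !(mul0mx, mulmx0, addr0) mulmx1.
  by rewrite scale_col_mx scaler0.
- rewrite -mulmxA /N /base_pt !mul_block_col !(mul0mx, mulmx0, addr0) mulmx1 KK.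
  rewrite col_mx_eq0 negb_and oppr_eq0; apply/orP; left.
  apply/eqP => /matrixP /(_ i i); rewrite !mxE !eqxx (negPf ij) /= addr0.
  by move/eqP; rewrite oner_eq0.
Qed.

(** A = 0 and B is a multiple of a matrix unit: one column describes a great
    circle. *)
Lemma circle_loop : (0 < p < n)%N -> loop_lengths n p beta (2 * pi).
Proof.
move=> /andP[p0 pltn]; pose i : 'I_p := Ordinal p0.
have q0 : (0 < n - p)%N by rewrite subn_gt0.
pose j : 'I_(n - p) := Ordinal q0.
pose E : 'M[R]_(n - p, p) := delta_mx j i.
pose B := (2 * pi) *: E.
pose N : 'M[R]_(p + (n - p)) := block_mx 0 (- E^T) E 0.
have -> : 2 * pi = Num.sqrt (beta * frob (0 : 'M[R]_p) 0 + frob B B).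
  rewrite frob0r mulr0 add0r /B frobZl frobZr frob_delta mxE !eqxx mulr1.
  by rewrite -expr2 sqrtr_sqr ger0_norm // mulr_ge0 // pi_ge0.
apply: (@rodrigues_loop_length 0 B N) => //.
- by rewrite trmx0 oppr0.
- rewrite /N !mulmx_block !(mul0mx, mulmx0, addr0, add0r).
  rewrite !opp_block_mx !oppr0 opprK.
  by rewrite /E trmx_delta !(mulNmx, mulmxN) !mul_delta_mx opprK.
- rewrite /N /lgen /B scaler0 linearZ /= -scalerN.
  rewrite !mulmx_block !(mul0mx, mulmx0, addr0, add0r).
  by rewrite -!scalemxAl -!scalemxAr.
- rewrite /N /base_pt mul_block_col !(mul0mx, mulmx0, addr0) mulmx1.
  by rewrite scale_col_mx scaler0.
- rewrite -mulmxA /N /base_pt !mul_block_col.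
  rewrite !(mul0mx, mulmx0, addr0, add0r) mulmx1.
  rewrite /E trmx_delta mulNmx mul_delta_mx.
  rewrite col_mx_eq0 negb_and oppr_eq0; apply/orP; left.
  apply/eqP => /matrixP /(_ i i); rewrite !mxE !eqxx /=.
  by move/eqP; rewrite oner_eq0.
Qed.

End Witnesses.

Theorem theorem3p4 (R : realType) (n p : nat) (hnp : (2 <= p <= n - 1)%N)
    (beta : R) (hbeta0 : 0 < beta) (hbeta2 : beta <= 2) :
  shortest_loop_length n p beta
    (Num.min (Num.sqrt (2 * beta)) 1 * (2 * pi)).
Proof.
have pn : (p <= n)%N by lia.
split; last first.
  move=> _ [U [D [T [loop ->]]]]; have [UU tD _ _ _] := loop.
  exact: geodesic_loop_length_ge.
have [_|_] := leP (Num.sqrt (2 * beta)) 1.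
  by apply: rotation_loop; [|exact: ltW|lia].
by rewrite mul1r; apply: circle_loop; lia.
Qed.
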